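(* Let $n,m\geq 9$ be integers. Let $a$ be the largest integer with $a\le n$ and $a\equiv 2\pmod 7$, and $b$ the largest integer with $b\le m$ and $b\equiv 2\pmod 7$ (so $0\le n-a\le 6$, $0\le m-b\le 6$). Define $\alpha=0$ if $m\bmod 7=2$, $\alpha=1$ if $m\bmod 7\in\{3,4\}$, $\alpha=2$ if $m\bmod 7\in\{5,6\}$, $\alpha=3$ if $m\bmod 7\in\{0,1\}$; and define $\beta$ in the same way with $n$ in place of $m$. Then $$\gamma^{\infty}_{all}(P_m\boxtimes P_n)\leq \frac{ab}{7}+\frac{8}{7}(a+b-1)+\alpha\left\lceil\frac{n}{2}\right\rceil+\beta\left\lceil\frac{m}{2}\right\rceil-\alpha\beta.$$
   Context: $P_m\boxtimes P_n$ is the strong grid: vertex set $\{0,\dots,m-1\}\times\{0,\dots,n-1\}$, with $(i_1,j_1)$ adjacent to $(i_2,j_2)$ iff $\max\{|i_1-i_2|,|j_1-j_2|\}=1$. Eternal domination game (all-guards-move model): $k$ guards are placed on distinct vertices of a graph $G$ forming a dominating set; at each turn an attacker chooses a vertex, and then every guard may stay in place or move to an adjacent vertex, with no two guards ending on the same vertex, and some guard must end on the attacked vertex. $\gamma^{\infty}_{all}(G)$ is the minimum $k$ such that $k$ guards have a strategy to do this against every infinite sequence of attacks. *)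

(* Defs.v *)
From HB Require Import structures.
From mathcomp Require Import all_boot all_order all_algebra.
Set Implicit Arguments. Unset Strict Implicit. Unset Printing Implicit Defensive.
Import Order.TTheory GRing.Theory Num.Theory.

Definition absd (x y : nat) : nat := (x - y) + (y - x).

Definition strong_adj (m n : nat) : rel ('I_m * 'I_n) :=
  fun u v => maxn (absd u.1 v.1) (absd u.2 v.2) == 1.

Section Game.
Variables (V : finType) (adj : rel V).

Definition dominating (D : {set V}) : Prop :=
  forall v : V, exists2 u, u \in D & (u == v) || adj u v.

Definition guard_move (D D' : {set V}) : Prop :=
  exists f : V -> V,
    [/\ {in D &, injective f},
        (forall x, x \in D -> f x = x \/ adj x (f x))
      & D' = f @: D].

(* k guards have a strategy defending against every (infinite) sequence of
   attacks: sigma s is the guard configuration after the attack sequence s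
   (history-dependent strategy); the initial configuration sigma [::] is a
   dominating set of k distinct vertices, and each attack v is answered by a
   legal move ending with a guard on v. *)
Definition eternal_all_win (k : nat) : Prop :=
  exists sigma : seq V -> {set V},
    [/\ #|sigma [::]| = k,
        dominating (sigma [::])
      & forall (s : seq V) (v : V),
          guard_move (sigma s) (sigma (rcons s v)) /\ v \in sigma (rcons s v)].

End Game.

Definition alpha_coef (m : nat) : nat :=
  match m %% 7 with
  | 2 => 0 | 3 | 4 => 1 | 5 | 6 => 2 | _ => 3
  end.

(* Main.v *)
(* Split the grid into a (7t+2) x (7s+2) main rectangle, with s, t > 0, and an
   L-shaped margin.  The margin is cut into cliques by the aligned 2 x 2 blocks
   of the whole grid, and one guard per block defends it.  On the main
   rectangle the interior guards form a lattice X + 3Y = c (mod 7) or its mirror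
   image -X + 3Y = c' (mod 7).  Every cell is guarded in some configuration of
   the kind not currently in use, and all guards switch to it.  Between two
   mirror lattices there is a matching by king moves with zero net displacement per
   period, so that the outer ring, which keeps its four corners and five guards
   in every seven consecutive cells of a side, can absorb the exchange near the
   sides by moves that depend only on the residues of the position.  This makes
   all the transitions a finite verification. *)
Require Import Defs.
From HB Require Import structures.
From mathcomp Require Import all_boot all_order all_algebra.
From mathcomp Require Import zify lra.
Import Order.TTheory GRing.Theory Num.Theory.

Set Implicit Arguments.
Unset Strict Implicit.
Unset Printing Implicit Defensive.

(** * Strategies with states, and ways to build legal moves *)

Section Strategy.
Variables (V : finType) (adj : rel V).

(** The history is folded into a state. Domination at the start needs no separate check: any vertex
    may be the first attack, and the guard answering it stands on it or next to it. *)
Lemma eternal_all_win_states (S : Type) (conf : S -> {set V})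
    (next : S -> V -> S) (inv : S -> Prop) (s0 : S) :
    inv s0 ->
    (forall s v, inv s ->
      [/\ inv (next s v), guard_move adj (conf s) (conf (next s v))
        & v \in conf (next s v)]) ->
  eternal_all_win adj #|conf s0|.
Proof.
move=> inv0 step; exists (fun h => conf (foldl next s0 h)).
have invP h : inv (foldl next s0 h).
  elim/last_ind: h => [//|h v IHh]; rewrite foldl_rcons.
  by have [] := step _ v IHh.
split=> [//|v /=|h v].
  have [_ [f [_ fP ->]] /imsetP[u Du ->]] := step _ v inv0.
  by exists u => //; case: (fP u Du) => ->; rewrite ?eqxx ?orbT.
by rewrite foldl_rcons; have [] := step _ v (invP h).
Qed.

Lemma guard_move_refl (D : {set V}) : guard_move adj D D.
Proof.
by exists id; split=> [u w _ _|u _|] //; [left | rewrite imset_id].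
Qed.

Lemma guard_moveU (D1 D2 E1 E2 : {set V}) :
    [disjoint D1 & D2] -> [disjoint E1 & E2] ->
    guard_move adj D1 E1 -> guard_move adj D2 E2 ->
  guard_move adj (D1 :|: D2) (E1 :|: E2).
Proof.
move=> dD dE [f [fI fP fE]] [g [gI gP gE]].
pose h u := if u \in D1 then f u else g u.
have h1 u : u \in D1 -> h u = f u by rewrite /h => ->.
have h2 u : u \in D2 -> h u = g u.
  by rewrite /h => Du; rewrite (disjointFl dD Du).
have sep u w : u \in D1 -> w \in D2 -> f u <> g w.
  move=> Du Dw E; have : f u \in E1 by rewrite fE imset_f.
  by move/(disjointFr dE); rewrite E gE imset_f.
exists h; split.
- move=> u w /setUP[] Du /setUP[] Dw; rewrite ?(h1 _ Du) ?(h2 _ Du)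
    ?(h1 _ Dw) ?(h2 _ Dw).
  + exact: fI.
  + by move/(sep _ _ Du Dw).
  + by move/esym/(sep _ _ Dw Du).
  + exact: gI.
- move=> u /setUP[] Du; rewrite ?(h1 _ Du) ?(h2 _ Du); [exact: fP|exact: gP].
- rewrite imsetU fE gE; congr (_ :|: _).
    exact/esym/eq_in_imset.
  exact/esym/eq_in_imset.
Qed.

(** A bijection presented as a relation, because the moves below are known only by local rules, read
    from either end. *)
Lemma guard_move_correspondence (e : rel V) (D E : {set V}) :
    (forall u, u \in D -> exists2 w, w \in E & e u w) ->
    (forall w, w \in E -> exists2 u, u \in D & e u w) ->
    (forall u w w', e u w -> e u w' -> w = w') ->
    (forall u u' w, u \in D -> u' \in D -> w \in E ->
       e u w -> e u' w -> u = u') ->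
    (forall u w, e u w -> w = u \/ adj u w) ->
  guard_move adj D E.
Proof.
move=> eD eE funE injE adjE.
pose f u := odflt u [pick w in E | e u w].
have fP u : u \in D -> f u \in E /\ e u (f u).
  move=> Du; rewrite /f; case: pickP => [w /andP[] //|none].
  by have [w Ew euw] := eD u Du; move: (none w); rewrite /= Ew euw.
exists f; split.
- move=> u u' Du Du' E1; have [Ew e1] := fP u Du; have [_ e2] := fP u' Du'.
  by apply: injE Du Du' Ew e1 _; rewrite E1.
- by move=> u Du; apply: adjE; case: (fP u Du).
- apply/setP=> w; apply/idP/imsetP => [Ew|[u Du ->]]; last by case: (fP u Du).
  have [u Du euw] := eE w Ew; exists u => //.
  by apply: funE euw _; case: (fP u Du).
Qed.

(** The inverse bijection is again a move, so only the moves towards mirror lattices have to be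
    tabulated. *)
Lemma guard_move_sym (D E : {set V}) :
  symmetric adj -> guard_move adj D E -> guard_move adj E D.
Proof.
move=> adjC [f [fI fP ->]].
apply: (@guard_move_correspondence
          (fun w u => [&& u \in D & f u == w])).
- by move=> w /imsetP[u Du ->]; exists u; rewrite // Du eqxx.
- by move=> u Du; exists (f u); rewrite ?imset_f // Du eqxx.
- by move=> w u u' /andP[Du /eqP<-] /andP[Du' /eqP /esym]; apply: fI.
- by move=> w w' u _ _ _ /andP[_ /eqP<-] /andP[_ /eqP<-].
- move=> w u /andP[Du /eqP<-]; case: (fP u Du) => [->|]; first by left.
  by rewrite adjC; right.
Qed.

Section Cliques.
Variables (B : eqType) (block : V -> B) (R : {set V}).
Hypothesis block_clique :
  forall u w, block u = block w -> w = u \/ adj u w.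

Definition block_transversal (T : {set V}) : Prop :=
  [/\ T \subset R, {in T &, injective block}
    & forall v, v \in R -> exists2 u, u \in T & block u = block v].

Definition block_swap (T : {set V}) (v : V) : {set V} :=
  v |: [set u in T | block u != block v].

Lemma block_swap_transversal T v :
  v \in R -> block_transversal T -> block_transversal (block_swap T v).
Proof.
move=> Rv [TR TI TP]; split.
- apply/subsetP=> u /setU1P[-> //|]; rewrite inE => /andP[Tu _].
  exact: (subsetP TR).
- move=> u w /setU1P[->|/setIdP[Tu Nu]] /setU1P[->|/setIdP[Tw Nw]] //.
  + by move=> E; rewrite E eqxx in Nw.
  + by move=> E; rewrite E eqxx in Nu.
  + exact: TI.
- move=> w Rw; case: (eqVneq (block w) (block v)) => [->|N].
    by exists v; rewrite ?setU11.
  have [u Tu E] := TP w Rw.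
  by exists u; rewrite // !inE Tu E N orbT.
Qed.

(** Only the guard of the attacked block moves; it can reach [v] because a block is a clique. *)
Lemma block_swap_move T v :
  v \in R -> block_transversal T -> guard_move adj T (block_swap T v).
Proof.
move=> Rv [TR TI TP].
exists (fun u => if block u == block v then v else u); split.
- move=> u w Tu Tw /=; case: eqP => [Eu|Nu]; case: eqP => [Ew|Nw] // E.
  + by apply: TI; rewrite // Eu Ew.
  + by case: Nw; rewrite E.
  + by case: Nu; rewrite E.
- by move=> u _; case: eqP => [/block_clique //|_]; left.
- apply/setP=> w; apply/idP/imsetP => [/setU1P[->|/setIdP[Tw Nw]]|[u Tu ->]].
  + by have [u Tu E] := TP v Rv; exists u; rewrite // E eqxx.
  + by exists w; rewrite // (negPf Nw).
  + by case: ifP => [_|N]; rewrite !inE ?eqxx // Tu N orbT.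
Qed.

End Cliques.
End Strategy.

(** * Guard patterns, tabulated moves and their finite verification *)

(* A position is described by two cell types: 0 outside the rectangle, 1 and 9
   on its two sides, 2..8 the residue of an interior coordinate modulo 7.
   The c-th entries below are the unguarded types on the sides X = 1 and Y = 1;
   the half-turn, which exchanges the classes c and 12 - c, gives the sides
   X = 9 and Y = 9.  The two tables were found by a computer search for
   configurations admitting all the transitions. *)
Definition vertical_holes : seq (seq nat) :=
  [:: [:: 4; 6]; [:: 2; 4]; [:: 4; 7]; [:: 5; 7]; [:: 2; 5]; [:: 4; 7];
      [:: 6; 8]].
Definition horizontal_holes : seq (seq nat) :=
  [:: [:: 3; 7]; [:: 4; 8]; [:: 2; 5]; [:: 2; 5]; [:: 4; 7]; [:: 4; 7];
      [:: 2; 6]].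

Definition side_guard (holes : seq nat) (Z : nat) : bool :=
  [&& 1 < Z, Z < 9 & Z \notin holes].

Definition guard0 (c X Y : nat) : bool :=
  let c' := (12 - c) %% 7 in
  if (1 < X < 9) && (1 < Y < 9) then (X + 3 * Y) %% 7 == c
  else if (X \in [:: 1; 9]) && (Y \in [:: 1; 9]) then true
  else if X == 1 then side_guard (nth [::] vertical_holes c) Y
  else if X == 9 then side_guard (nth [::] vertical_holes c') (10 - Y)
  else if Y == 1 then side_guard (nth [::] horizontal_holes c) X
  else (Y == 9) && side_guard (nth [::] horizontal_holes c') (10 - X).

Definition guard (st : bool * nat) (X Y : nat) : bool :=
  guard0 st.2 (if st.1 then 10 - X else X) Y.

Definition guards0 (c : nat) : seq (nat * nat) :=
  [seq P <- [seq (X, Y) | X <- iota 1 9, Y <- iota 1 9] | guard0 c P.1 P.2].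

(* Entry (c, c') lists the moves from the c-th lattice to the c'-th mirror
   lattice, for the guards in the order of guards0 c.  The digits are placed as
   on a numeric keypad: 5 stays, 4 and 6 change X, 2 and 8 change Y. *)
Definition keypad_moves : seq (seq (seq nat)) :=
  [:: [:: [:: 5; 6; 2; 5; 8; 2; 5; 5; 4; 5; 3; 6; 1; 4; 4; 5; 5; 5; 9; 7; 4; 5; 6; 5; 5; 8; 8; 1; 8; 2; 5];
      [:: 5; 8; 2; 2; 2; 2; 5; 6; 9; 5; 7; 5; 6; 4; 5; 4; 5; 6; 3; 1; 4; 5; 5; 5; 5; 8; 8; 8; 8; 2; 5];
      [:: 5; 5; 8; 8; 8; 2; 5; 5; 3; 6; 1; 4; 5; 5; 4; 9; 6; 5; 7; 6; 6; 4; 4; 4; 8; 2; 2; 5; 2; 8; 2];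
      [:: 5; 9; 2; 2; 8; 2; 5; 5; 7; 6; 6; 4; 4; 5; 4; 3; 6; 5; 1; 5; 6; 4; 9; 4; 8; 2; 7; 2; 2; 8; 2];
      [:: 8; 3; 8; 5; 5; 8; 6; 4; 1; 2; 5; 5; 9; 4; 5; 7; 6; 7; 6; 4; 5; 4; 3; 6; 4; 8; 1; 2; 2; 2; 2];
      [:: 5; 8; 2; 5; 8; 2; 5; 5; 6; 5; 4; 5; 3; 5; 5; 1; 5; 6; 5; 9; 4; 5; 7; 5; 8; 2; 2; 5; 2; 8; 2];
      [:: 6; 2; 5; 5; 2; 2; 2; 9; 5; 4; 9; 4; 7; 5; 5; 6; 5; 5; 4; 3; 2; 6; 1; 4; 8; 8; 8; 2; 5; 8; 4]];
      [:: [:: 5; 2; 2; 2; 8; 2; 5; 5; 5; 5; 6; 9; 7; 4; 6; 6; 5; 4; 4; 6; 3; 4; 1; 5; 5; 5; 5; 8; 8; 8; 5];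
      [:: 5; 5; 2; 5; 6; 2; 5; 6; 4; 5; 6; 3; 1; 4; 5; 5; 5; 6; 9; 6; 7; 4; 6; 5; 5; 4; 5; 8; 5; 8; 5];
      [:: 5; 2; 2; 5; 8; 2; 5; 5; 9; 6; 5; 7; 6; 5; 4; 4; 6; 5; 3; 5; 1; 6; 5; 4; 5; 5; 5; 8; 5; 8; 5];
      [:: 5; 2; 2; 2; 8; 2; 5; 5; 3; 6; 6; 1; 5; 1; 6; 9; 4; 8; 7; 5; 6; 6; 4; 4; 5; 5; 8; 2; 5; 8; 5];
      [:: 5; 2; 2; 2; 9; 2; 5; 5; 7; 5; 6; 6; 4; 4; 5; 3; 5; 6; 1; 6; 5; 4; 9; 4; 5; 7; 8; 2; 8; 2; 5];
      [:: 8; 5; 5; 6; 5; 8; 6; 5; 1; 1; 9; 5; 9; 6; 4; 7; 6; 4; 6; 5; 4; 6; 3; 6; 5; 1; 2; 2; 2; 8; 1];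
      [:: 5; 5; 5; 5; 8; 2; 5; 5; 6; 6; 5; 4; 3; 5; 5; 1; 5; 5; 5; 5; 9; 5; 7; 5; 5; 5; 8; 2; 2; 5; 5]];
      [:: [:: 6; 2; 2; 2; 2; 2; 2; 6; 4; 6; 4; 4; 6; 3; 4; 1; 5; 5; 4; 6; 9; 4; 6; 7; 8; 8; 8; 8; 8; 8; 4];
      [:: 5; 8; 2; 2; 5; 2; 5; 5; 5; 5; 9; 5; 5; 7; 6; 6; 4; 4; 5; 5; 3; 6; 5; 1; 5; 8; 8; 5; 8; 2; 5];
      [:: 5; 5; 8; 6; 5; 5; 5; 4; 6; 4; 3; 6; 4; 1; 2; 5; 5; 9; 5; 5; 7; 6; 7; 6; 8; 2; 2; 7; 2; 8; 2];
      [:: 6; 2; 2; 2; 2; 2; 2; 9; 4; 5; 7; 5; 5; 6; 5; 4; 5; 3; 5; 5; 1; 5; 6; 5; 8; 8; 5; 5; 8; 8; 4];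
      [:: 5; 8; 2; 2; 2; 2; 5; 3; 2; 6; 1; 4; 6; 5; 4; 9; 7; 7; 5; 5; 6; 5; 5; 4; 5; 8; 5; 5; 8; 2; 5];
      [:: 5; 8; 2; 5; 6; 2; 5; 7; 5; 4; 6; 6; 5; 4; 6; 3; 4; 1; 5; 5; 5; 6; 5; 9; 5; 5; 2; 2; 8; 4; 5];
      [:: 6; 2; 5; 3; 2; 2; 2; 1; 4; 5; 5; 5; 6; 9; 5; 7; 5; 6; 4; 5; 4; 5; 6; 3; 8; 8; 8; 8; 1; 8; 4]];
      [:: [:: 5; 6; 2; 8; 8; 5; 5; 1; 5; 4; 5; 5; 5; 9; 6; 7; 4; 6; 5; 4; 4; 6; 5; 3; 5; 8; 8; 1; 8; 2; 5];
      [:: 5; 8; 2; 5; 5; 2; 5; 6; 5; 5; 4; 5; 5; 3; 6; 1; 6; 5; 1; 6; 9; 4; 8; 7; 5; 8; 8; 8; 8; 2; 5];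
      [:: 6; 2; 2; 5; 5; 2; 2; 5; 4; 5; 9; 5; 5; 7; 5; 6; 5; 4; 5; 5; 3; 5; 6; 1; 8; 8; 8; 8; 8; 8; 4];
      [:: 5; 9; 2; 5; 8; 5; 5; 4; 6; 4; 3; 6; 5; 1; 1; 5; 8; 9; 6; 4; 7; 6; 4; 6; 8; 2; 7; 2; 2; 8; 2];
      [:: 5; 8; 2; 5; 2; 2; 5; 9; 5; 4; 7; 5; 5; 6; 6; 4; 4; 3; 5; 5; 1; 5; 5; 5; 5; 8; 5; 8; 8; 2; 5];
      [:: 5; 8; 2; 8; 8; 5; 5; 3; 5; 4; 1; 6; 5; 5; 6; 9; 4; 7; 5; 5; 6; 6; 5; 4; 5; 5; 2; 5; 2; 5; 5];
      [:: 6; 2; 9; 2; 2; 2; 2; 7; 4; 5; 6; 5; 6; 4; 5; 3; 5; 1; 4; 5; 5; 5; 6; 9; 8; 8; 8; 7; 5; 8; 4]];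
      [:: [:: 5; 2; 8; 8; 8; 9; 5; 8; 7; 4; 6; 5; 4; 6; 4; 3; 6; 4; 1; 5; 1; 5; 9; 5; 8; 2; 5; 8; 1; 5; 2];
      [:: 5; 8; 2; 5; 6; 2; 5; 6; 1; 6; 5; 4; 9; 4; 5; 7; 5; 6; 6; 4; 4; 5; 3; 5; 5; 4; 5; 8; 8; 8; 5];
      [:: 5; 2; 5; 5; 8; 2; 5; 5; 6; 5; 4; 5; 3; 2; 6; 1; 4; 9; 5; 9; 4; 4; 7; 5; 5; 5; 5; 8; 8; 8; 5];
      [:: 5; 2; 5; 2; 8; 2; 5; 5; 5; 5; 9; 5; 7; 5; 4; 6; 6; 5; 4; 3; 6; 4; 1; 4; 5; 5; 8; 2; 8; 8; 5];
      [:: 5; 2; 5; 2; 9; 2; 5; 5; 4; 6; 3; 4; 1; 4; 5; 5; 5; 6; 9; 7; 4; 5; 6; 4; 5; 7; 8; 2; 8; 5; 5];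
      [:: 5; 2; 2; 2; 8; 2; 5; 5; 9; 6; 7; 4; 6; 5; 5; 4; 5; 6; 3; 1; 4; 5; 5; 5; 5; 5; 5; 8; 8; 8; 5];
      [:: 5; 5; 8; 5; 8; 2; 5; 5; 3; 5; 1; 5; 5; 5; 5; 9; 5; 5; 7; 6; 5; 4; 4; 5; 5; 5; 5; 8; 2; 5; 5]];
      [:: [:: 8; 2; 8; 5; 8; 8; 2; 5; 3; 5; 6; 1; 5; 4; 6; 9; 5; 4; 7; 5; 6; 5; 4; 5; 5; 5; 5; 5; 8; 2; 5];
      [:: 5; 8; 8; 8; 8; 3; 6; 7; 7; 6; 5; 6; 4; 6; 4; 3; 6; 6; 1; 1; 5; 5; 9; 6; 7; 2; 5; 5; 2; 7; 2];
      [:: 5; 5; 8; 6; 5; 5; 5; 5; 1; 6; 5; 5; 9; 5; 4; 7; 6; 5; 6; 6; 4; 4; 3; 5; 8; 2; 5; 8; 4; 8; 2];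
      [:: 5; 5; 8; 5; 8; 5; 5; 5; 6; 6; 5; 4; 3; 5; 4; 1; 6; 5; 5; 6; 9; 4; 7; 5; 8; 2; 5; 2; 2; 8; 2];
      [:: 5; 8; 2; 2; 2; 2; 5; 5; 5; 5; 6; 9; 7; 4; 5; 6; 5; 6; 4; 5; 3; 5; 1; 4; 5; 8; 8; 8; 8; 2; 5];
      [:: 5; 8; 2; 5; 6; 2; 5; 5; 4; 5; 6; 3; 1; 5; 5; 5; 5; 6; 9; 5; 7; 5; 6; 5; 5; 5; 5; 5; 8; 4; 5];
      [:: 6; 2; 5; 5; 5; 2; 2; 9; 9; 4; 5; 7; 6; 5; 5; 4; 5; 5; 3; 3; 1; 6; 5; 4; 8; 8; 8; 5; 5; 8; 4]];
      [:: [:: 6; 2; 2; 5; 5; 5; 2; 9; 4; 7; 7; 5; 5; 6; 5; 4; 5; 3; 5; 6; 1; 1; 6; 5; 8; 5; 5; 8; 8; 8; 4];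
      [:: 5; 8; 2; 5; 8; 5; 5; 3; 5; 5; 1; 5; 5; 5; 5; 9; 5; 7; 5; 5; 6; 6; 5; 4; 5; 5; 8; 2; 8; 2; 5];
      [:: 6; 2; 2; 5; 6; 2; 2; 7; 4; 5; 6; 5; 5; 4; 6; 3; 4; 1; 5; 5; 5; 5; 6; 9; 8; 5; 8; 7; 8; 8; 4];
      [:: 6; 2; 2; 3; 2; 5; 2; 1; 4; 5; 5; 5; 5; 9; 6; 7; 4; 6; 5; 5; 4; 5; 6; 3; 8; 8; 4; 5; 8; 8; 4];
      [:: 5; 8; 2; 5; 5; 5; 5; 6; 5; 4; 4; 5; 5; 3; 5; 1; 5; 5; 5; 5; 9; 5; 5; 7; 5; 5; 2; 5; 8; 2; 5];
      [:: 6; 2; 2; 2; 5; 5; 5; 5; 1; 9; 9; 4; 5; 7; 5; 6; 5; 4; 5; 5; 3; 6; 6; 1; 8; 5; 5; 5; 8; 8; 1];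
      [:: 6; 2; 9; 2; 5; 5; 2; 4; 4; 5; 3; 5; 6; 1; 6; 5; 4; 9; 4; 5; 7; 5; 6; 6; 8; 5; 5; 8; 1; 8; 4]]].

(* Both components are shifted by one, so that 1 means no displacement. *)
Definition move (c c' X Y : nat) : nat * nat :=
  let k := nth 0 (nth [::] (nth [::] keypad_moves c) c')
             (index (X, Y) (guards0 c)) in
  (k.-1 %% 3, (k.-1 %/ 3) %% 3).

(* All the possible types of three consecutive coordinates, including the
   types outside next to a side. *)
Definition windows : seq (seq nat) :=
  [:: [:: 0; 1; 2], [:: 8; 9; 0], [:: 7; 8; 2], [:: 8; 2; 3]
    & [seq iota k 3 | k <- iota 1 7]].

Definition moves_land (c c' : nat) : bool :=
  all (fun W => all (fun W' =>
    guard0 c (nth 0 W 1) (nth 0 W' 1) ==>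
      let d := move c c' (nth 0 W 1) (nth 0 W' 1) in
      guard (true, c') (nth 0 W d.1) (nth 0 W' d.2)) windows) windows.

(** Places in the 3 x 3 window whose guard moves to the centre. From index [i] to the centre 1 the
    displacement is [1 - i], hence the code [2 - i]. *)
Definition moves_from (c c' : nat) (W W' : seq nat) : seq (nat * nat) :=
  [seq d <- [seq (i, j) | i <- iota 0 3, j <- iota 0 3] |
    guard0 c (nth 0 W d.1) (nth 0 W' d.2)
    && (move c c' (nth 0 W d.1) (nth 0 W' d.2) == (2 - d.1, 2 - d.2))].

(** Exactly one arrival per target gives surjectivity and injectivity at once. *)
Definition moves_fill (c c' : nat) : bool :=
  all (fun W => all (fun W' =>
    if guard (true, c') (nth 0 W 1) (nth 0 W' 1)
    then size (moves_from c c' W W') == 1 else true) windows) windows.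

Lemma moves_landP : all (fun c => all (moves_land c) (iota 0 7)) (iota 0 7).
Proof. by vm_compute. Qed.

Lemma moves_fillP : all (fun c => all (moves_fill c) (iota 0 7)) (iota 0 7).
Proof. by vm_compute. Qed.

(* Unification would otherwise unfold move into its tables. *)
#[local] Opaque move.

(** Type 0 is never guarded, so a move landing on a guarded type stays inside the rectangle. *)
Lemma guard_pos st X Y : guard st X Y -> 0 < X /\ 0 < Y.
Proof.
case: st => o c H; split; rewrite lt0n; apply: contraTneq H => ->.
  by rewrite /guard /guard0 /side_guard; case: o => /=; case: ifP => // _;
     case: eqP => // ->.
by rewrite /guard /guard0 /side_guard; case: o => /=;
   rewrite ?andbF /=; case: ifP => //; rewrite ?inE //=;
   do ?case: ifP => //.
Qed.

(** * Periodic coordinates and sums over them *)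

(* Coordinates are numbered from 1 to 7 s + 2. *)
Definition cell_type (s z : nat) : nat :=
  if z <= 1 then z
  else if z == 7 * s + 2 then 9
  else if 7 * s + 2 < z then 0
  else (z - 2) %% 7 + 2.

Lemma cell_type_gt0 s z : 0 < cell_type s z -> 0 < z <= 7 * s + 2.
Proof. by rewrite /cell_type; do !case: ifP; lia. Qed.

Lemma cell_type_range s z : 0 < z <= 7 * s + 2 -> 0 < cell_type s z < 10.
Proof. by rewrite /cell_type; do !case: ifP; lia. Qed.

Lemma cell_type_inner s z :
  1 < z < 7 * s + 2 -> cell_type s z = (z - 2) %% 7 + 2.
Proof. by rewrite /cell_type; do !case: ifP; lia. Qed.

Lemma cell_type_hi s : 0 < s -> cell_type s (7 * s + 2) = 9.
Proof. by rewrite /cell_type; do !case: ifP; lia. Qed.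

Lemma cell_type_out s z : 7 * s + 2 < z -> cell_type s z = 0.
Proof. by rewrite /cell_type; do !case: ifP; lia. Qed.

Definition window (s z : nat) : seq nat :=
  [:: cell_type s z.-1; cell_type s z; cell_type s z.+1].

Lemma window_nth s z i : i < 3 -> nth 0 (window s z) i = cell_type s (z + i).-1.
Proof.
by case: i => [|[|[|]]] //= _; congr cell_type; lia.
Qed.

(** The ends and the passage from residue type 8 back to 2 produce the four exceptional windows;
    [0 < s] keeps the two ends from being neighbours. *)
Lemma window_in s z :
  0 < s -> 0 < z <= 7 * s + 2 -> window s z \in windows.
Proof.
move=> s0 zs; rewrite /window.
have inner r y : 1 < y < 7 * s + 2 -> (y - 2) %% 7 = r -> cell_type s y = r + 2.
  by move=> yP <-; rewrite cell_type_inner.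
have [z1|z1] := eqVneq z 1; first by rewrite z1 /= (inner 0 2) //; lia.
have [z2|z2] := eqVneq z (7 * s + 2).
  have -> : cell_type s z = 9 by rewrite z2 cell_type_hi.
  by rewrite (@cell_type_out s z.+1) ?(inner 6 z.-1) //; lia.
have low : z = 2 -> cell_type s z.-1 = 1 by move->.
have high : z = 7 * s + 1 -> cell_type s z.+1 = 9.
  by move->; rewrite -addnS cell_type_hi.
have [r rE] : exists r, (z - 2) %% 7 = r by eexists.
rewrite (inner r z) //; last lia.
have : r < 7 by rewrite -rE ltn_mod.
have [z3|z3] := eqVneq z 2.
  rewrite low // (inner 1 z.+1); try lia.
  by rewrite (_ : r = 0) //; lia.
have [z4|z4] := eqVneq z (7 * s + 1).
  rewrite high // (inner 5 z.-1); try lia.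
  by rewrite (_ : r = 6) //; lia.
case: r rE => [|[|[|[|[|[|[|]]]]]]] // rE _.
- by rewrite (inner 6 z.-1) ?(inner 1 z.+1) //; lia.
- by rewrite (inner 0 z.-1) ?(inner 2 z.+1) //; lia.
- by rewrite (inner 1 z.-1) ?(inner 3 z.+1) //; lia.
- by rewrite (inner 2 z.-1) ?(inner 4 z.+1) //; lia.
- by rewrite (inner 3 z.-1) ?(inner 5 z.+1) //; lia.
- by rewrite (inner 4 z.-1) ?(inner 6 z.+1) //; lia.
- by rewrite (inner 5 z.-1) ?(inner 0 z.+1) //; lia.
Qed.

Definition card_profile (F : nat -> nat) (s : nat) : nat :=
  F 1 + s * sumn [seq F k | k <- iota 2 7] + F 9.

(** The first [p] terms have type 0 and vanish. The others are two ends and [s] full periods. *)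
Lemma sum_cell_type (p s : nat) (F : nat -> nat) :
  F 0 = 0 ->
  \sum_(i < p + (7 * s + 2)) F (cell_type s (i.+1 - p)) = card_profile F s.
Proof.
move=> F0; rewrite /card_profile big_split_ord /= big1 ?add0n; last first.
  by move=> i _; rewrite (_ : _ - _ = 0) //; have := ltn_ord i; lia.
under eq_bigr => i _ do rewrite subSn ?leq_addr // addKn.
rewrite addn2 big_ord_recl big_ord_recr -addnA; congr (_ + (_ + _)).
  have per r : \sum_(i < r * 7) F (i %% 7 + 2) =
               r * sumn [seq F k | k <- iota 2 7].
    elim: r => [|r IHr]; first by rewrite big_ord0.
    rewrite !mulSnr big_split_ord IHr; congr (_ + _).
    under eq_bigr => i _ do rewrite modnMDl modn_small ?ltn_ord //.
    by rewrite !big_ord_recl big_ord0.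
  rewrite -per mulnC; apply: eq_bigr => i _; congr F.
  rewrite lift0 /cell_type /=; have := ltn_ord i.
  by do !case: ifP; lia.
by congr F; rewrite lift0 /cell_type /=; do !case: ifP; lia.
Qed.

(** Collects the coefficient of [s], so that counting guards needs only sums over one period. *)
Lemma card_profile_rows (G : nat -> nat -> nat) (s t : nat) :
  card_profile (fun X => card_profile (G X) s) t =
  card_profile (fun X => G X 1 + G X 9) t
  + s * card_profile (fun X => sumn [seq G X Y | Y <- iota 2 7]) t.
Proof. by rewrite /card_profile /=; lia. Qed.

(** * Consequences of the finite checks *)

Definition response (o : bool) (X Y : nat) : nat :=
  find (fun c => guard (o, c) X Y) (iota 0 7).

(** A check of the 9 x 9 pairs of types in both orientations; [find] would return 7 if no class
    guarded the cell. *)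
Lemma responseP o X Y :
  0 < X < 10 -> 0 < Y < 10 ->
  response o X Y < 7 /\ guard (o, response o X Y) X Y.
Proof.
have all_has : all (fun o => all (fun X => all (fun Y =>
    has (fun c => guard (o, c) X Y) (iota 0 7)) (iota 1 9)) (iota 1 9))
    [:: true; false] by vm_compute.
have o_in : o \in [:: true; false] by case: o.
move=> Xr Yr; move/allP/(_ o o_in): all_has.
move/allP/(_ X); rewrite mem_iota => /(_ Xr).
move/allP/(_ Y); rewrite mem_iota => /(_ Yr) H.
have lt7 : response o X Y < 7 by rewrite -[7](size_iota 0) -has_find.
by split=> //; have := nth_find 0 H; rewrite -/(response o X Y) nth_iota.
Qed.

Lemma move_lands c c' W W' :
    c < 7 -> c' < 7 -> W \in windows -> W' \in windows ->
    guard0 c (nth 0 W 1) (nth 0 W' 1) ->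
  let d := move c c' (nth 0 W 1) (nth 0 W' 1) in
  guard (true, c') (nth 0 W d.1) (nth 0 W' d.2).
Proof.
move=> c7 c7' Win W'in G.
have c_in : c \in iota 0 7 by rewrite mem_iota.
have c'_in : c' \in iota 0 7 by rewrite mem_iota.
have land := allP (allP moves_landP c c_in) c' c'_in.
exact: (implyP (allP (allP land W Win) W' W'in) G).
Qed.

Lemma move_fills c c' W W' :
    c < 7 -> c' < 7 -> W \in windows -> W' \in windows ->
    guard (true, c') (nth 0 W 1) (nth 0 W' 1) ->
  exists d, moves_from c c' W W' = [:: d].
Proof.
move=> c7 c7' Win W'in G.
have c_in : c \in iota 0 7 by rewrite mem_iota.
have c'_in : c' \in iota 0 7 by rewrite mem_iota.
have fill := allP (allP moves_fillP c c_in) c' c'_in.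
have := allP (allP fill W Win) W' W'in; rewrite G.
by case: (moves_from c c' W W') => [|d []] // _; exists d.
Qed.

Lemma strong_adj_near m n (u w : 'I_m * 'I_n) i j :
    w.1.+1 = u.1 + i -> i < 3 -> w.2.+1 = u.2 + j -> j < 3 ->
  w = u \/ strong_adj u w.
Proof.
case: u w => [x y] [x' y'] /= e1 i3 e2 j3; rewrite /strong_adj /absd /=.
have [x_eq|x_neq] := eqVneq (x' : nat) x; last by right; lia.
have [y_eq|y_neq] := eqVneq (y' : nat) y; last by right; lia.
by left; rewrite (ord_inj x_eq) (ord_inj y_eq).
Qed.

(** * Switching between mirror lattices on the main rectangle *)

Section Grid.
Variables p t q s : nat.
Local Notation m := (p + (7 * t + 2)).
Local Notation n := (q + (7 * s + 2)).
Local Notation V := ('I_m * 'I_n)%type.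

(* The rectangle occupies the high corner, [p, m) x [q, n).  In truncated
   subtraction every coordinate below p or q becomes 0, hence lies outside. *)
Definition row_type (u : V) : nat := cell_type t (u.1.+1 - p).
Definition col_type (u : V) : nat := cell_type s (u.2.+1 - q).

Definition main_guards (st : bool * nat) : {set V} :=
  [set u | guard st (row_type u) (col_type u)].

Definition moves_to (c c' : nat) (u w : V) : bool :=
  let d := move c c' (row_type u) (col_type u) in
  (w.1.+1 == u.1 + d.1) && (w.2.+1 == u.2 + d.2).

Lemma main_guards_coord st u :
  u \in main_guards st ->
  0 < u.1.+1 - p <= 7 * t + 2 /\ 0 < u.2.+1 - q <= 7 * s + 2.
Proof.
rewrite inE => /guard_pos[X0 Y0].
by split; apply: cell_type_gt0.
Qed.

Lemma ex_coord (r k z : nat) : 0 < z <= k ->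
  exists2 x : 'I_(r + k), x.+1 = r + z & x.+1 - r = z.
Proof.
move=> zP; have lt : (r + z).-1 < r + k by lia.
by exists (Ordinal lt) => /=; lia.
Qed.

Lemma shift_coord (r x i : nat) :
  0 < x.+1 - r -> r + (x.+1 - r + i).-1 = x + i.
Proof. lia. Qed.

Lemma rev_coord (x w i : nat) : x.+1 = w + i -> i < 3 -> w.+1 = x + (2 - i).
Proof. lia. Qed.

(** Here [v.+1 - w] is the index of the origin [v] in the window centred at the target [w]; it and
    the displacement code [i] add up to 2. *)
Lemma dir_coord (r v w i : nat) :
    w.+1 = v + i -> i < 3 -> 0 < w.+1 - r -> 0 < v.+1 - r ->
  [/\ v.+1 - w < 3, v = w + (v.+1 - w) - 1,
      (w.+1 - r + (v.+1 - w)).-1 = v.+1 - r & 2 - (v.+1 - w) = i].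
Proof. by move=> *; split; lia. Qed.

(** The landing check gives every guard a target; the filling check gives every target exactly one
    origin. *)
Lemma guard_move_main c c' :
  0 < t -> 0 < s -> c < 7 -> c' < 7 ->
  guard_move (@strong_adj m n)
    (main_guards (false, c)) (main_guards (true, c')).
Proof.
move=> t_gt0 s_gt0 c7 c7'.
have moveK X Y : (move c c' X Y).1 < 3 /\ (move c c' X Y).2 < 3.
  by rewrite !ltn_mod.
apply: (@guard_move_correspondence _ _ (moves_to c c')).
- move=> u Du; have [xP yP] := main_guards_coord Du.
  have Wx := window_in t_gt0 xP; have Wy := window_in s_gt0 yP.
  move: Du; rewrite inE => Du.
  have := move_lands c7 c7' Wx Wy Du.
  rewrite -/(row_type u) -/(col_type u).
  have [] := moveK (row_type u) (col_type u).
  rewrite /moves_to; case: (move _ _ _ _) => i j /= i3 j3.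
  rewrite !window_nth // => Gw.
  have [/cell_type_gt0 x'P /cell_type_gt0 y'P] := guard_pos Gw.
  have [x xE xK] := ex_coord p x'P; have [y yE yK] := ex_coord q y'P.
  exists (x, y); first by rewrite inE /row_type /col_type /= xK yK.
  move: xP yP => /andP[xP _] /andP[yP _].
  by rewrite /= xE yE !shift_coord ?eqxx.
- move=> w Ew; have [xP yP] := main_guards_coord Ew.
  have Wx := window_in t_gt0 xP; have Wy := window_in s_gt0 yP.
  move: Ew; rewrite inE => Ew.
  have [d E] := move_fills c7 c7' Wx Wy Ew.
  have : d \in moves_from c c' (window t (w.1.+1 - p)) (window s (w.2.+1 - q)).
    by rewrite E mem_head.
  rewrite mem_filter => /andP[/andP[Gu /eqP mE] /allpairsP[[i j] [i3 j3 dE]]].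
  move: i3 j3; rewrite !mem_iota => /andP[_ i3] /andP[_ j3].
  move: Gu mE; rewrite dE /= !window_nth // => Gu mE.
  have [/cell_type_gt0 x'P /cell_type_gt0 y'P] :=
    guard_pos (st := (false, c)) Gu.
  have [x xE xK] := ex_coord p x'P; have [y yE yK] := ex_coord q y'P.
  have xT : row_type (x, y) = cell_type t (w.1.+1 - p + i).-1.
    by rewrite /row_type xK.
  have yT : col_type (x, y) = cell_type s (w.2.+1 - q + j).-1.
    by rewrite /col_type yK.
  exists (x, y); first by rewrite inE xT yT.
  rewrite /moves_to xT yT mE.
  move: xP yP => /andP[xP _] /andP[yP _].
  move: xE yE; rewrite !shift_coord //= => xE yE.
  by rewrite (rev_coord xE i3) (rev_coord yE j3) !eqxx.
- move=> u [x y] [x' y']; rewrite /moves_to /= => /andP[/eqP e1 /eqP e2].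
  by rewrite -e1 -e2 !eqSS => /andP[/eqP/val_inj-> /eqP/val_inj->].
- move=> u u' w Du Du' Ew; have [xP yP] := main_guards_coord Ew.
  have Wx := window_in t_gt0 xP; have Wy := window_in s_gt0 yP.
  move: Ew; rewrite inE => Ew.
  have [d E] := move_fills c7 c7' Wx Wy Ew.
  (* Two guards reaching [w] have their window indices in the same one-element list [moves_from],
     hence equal positions. *)
  pose dir (v : V) : nat * nat := (v.1.+1 - w.1, v.2.+1 - w.2).
  have dirP (v : V) : v \in main_guards (false, c) -> moves_to c c' v w ->
    [/\ (v.1 : nat) = w.1 + (dir v).1 - 1, (v.2 : nat) = w.2 + (dir v).2 - 1
      & dir v \in
          moves_from c c' (window t (w.1.+1 - p)) (window s (w.2.+1 - q))].
    move=> Dv; have [/andP[x'P _] /andP[y'P _]] := main_guards_coord Dv.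
    have [] := moveK (row_type v) (col_type v).
    rewrite /moves_to /dir; move mE: (move _ _ _ _) => [i j] /= i3 j3.
    case/andP=> /eqP e1 /eqP e2.
    move: xP yP => /andP[xP _] /andP[yP _].
    have [d1 v1 n1 r1] := dir_coord e1 i3 xP x'P.
    have [d2 v2 n2 r2] := dir_coord e2 j3 yP y'P.
    split=> //; rewrite mem_filter allpairs_f ?mem_iota // andbT /=.
    rewrite !window_nth // n1 n2 r1 r2.
    rewrite -/(row_type v) -/(col_type v) mE eqxx andbT.
    by move: Dv; rewrite inE.
  move=> /(dirP _ Du)[ux uy ud] /(dirP _ Du')[u'x u'y u'd].
  have dd : dir u = dir u'.
    by move: ud u'd; rewrite E !inE => /eqP-> /eqP->.
  have x_eq : u.1 = u'.1 by apply: ord_inj; rewrite ux u'x dd.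
  have y_eq : u.2 = u'.2 by apply: ord_inj; rewrite uy u'y dd.
  by rewrite [u]surjective_pairing [u']surjective_pairing x_eq y_eq.
- move=> u w; rewrite /moves_to.
  have [] := moveK (row_type u) (col_type u).
  case: (move _ _ _ _) => i j /= i3 j3 /andP[/eqP e1 /eqP e2].
  exact: strong_adj_near e1 i3 e2 j3.
Qed.

Lemma strong_adj_sym : symmetric (@strong_adj m n).
Proof.
by move=> u w; rewrite /strong_adj /absd addnC [X in maxn _ X]addnC.
Qed.

Lemma card_main_guards c :
  #|main_guards (false, c)| =
  card_profile (fun X => card_profile (fun Y => guard (false, c) X Y) s) t.
Proof.
pose F X Y : nat := guard (false, c) X Y.
have F0l Y : F 0 Y = 0 by rewrite /F; case G: guard => //; case: (guard_pos G).
have F0r X : F X 0 = 0 by rewrite /F; case G: guard => //; case: (guard_pos G).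
have col X : card_profile (F X) s =
             \sum_(j < n) F X (cell_type s (j.+1 - q)).
  by rewrite (@sum_cell_type q s (F X)).
have F0 : card_profile (F 0) s = 0 by rewrite col big1.
rewrite -/F -(@sum_cell_type p t (fun X => card_profile (F X) s) F0).
under [RHS]eq_bigr do rewrite col.
rewrite -sum1_card pair_big /= big_mkcond /=; apply: eq_bigr => u _.
by rewrite inE /F /row_type /col_type; case: guard.
Qed.

(** * The margin and its 2 x 2 blocks *)

Definition margin : {set V} := [set u : V | (u.1 < p) || (u.2 < q)].

Definition block_corners : {set V} :=
  [set u in margin | ~~ odd u.1 && ~~ odd u.2].

Definition block (u : V) : nat * nat := ((u.1)./2, (u.2)./2).

Lemma block_clique (u w : V) : block u = block w -> w = u \/ strong_adj u w.
Proof.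
case=> e1 e2.
apply: (@strong_adj_near _ _ _ _ (w.1.+1 - u.1) (w.2.+1 - u.2)); lia.
Qed.

(** Rounding both coordinates down to even numbers stays in the margin, which lies on the low sides
    of the grid. *)
Lemma block_corners_transversal :
  block_transversal block margin block_corners.
Proof.
split; first by apply/subsetP=> u /setIdP[].
- move=> u w; rewrite !inE.
  move=> /andP[_ /andP[u1 u2]] /andP[_ /andP[w1 w2]] [e1 e2].
  rewrite [u]surjective_pairing [w]surjective_pairing.
  by congr (_, _); apply: ord_inj;
     [rewrite -(even_halfK u1) e1 even_halfK
     |rewrite -(even_halfK u2) e2 even_halfK].
- move=> [x y]; rewrite inE /= => xy.
  have x_lt : (x./2).*2 < m by have := ltn_ord x; lia.
  have y_lt : (y./2).*2 < n by have := ltn_ord y; lia.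
  exists (Ordinal x_lt, Ordinal y_lt); last by rewrite /block /= !doubleK.
  by rewrite !inE /= !odd_double andbT; lia.
Qed.

Lemma main_guards_margin st : [disjoint main_guards st & margin].
Proof.
rewrite -setI_eq0; apply/eqP/setP=> -[x y]; rewrite in_set0 in_setI.
by apply/negP=> /andP[/main_guards_coord /= [xP yP]]; rewrite inE /=; lia.
Qed.

Lemma notin_margin (v : V) :
  v \notin margin -> 0 < row_type v < 10 /\ 0 < col_type v < 10.
Proof.
case: v => x y; rewrite inE negb_or -!leqNgt /= => /andP[px qy].
by split; apply: cell_type_range => /=;
   [have := ltn_ord x | have := ltn_ord y]; lia.
Qed.

(** * The combined strategy *)

(** An attack on the rectangle flips the orientation even if the cell is already guarded, since only
    moves between opposite orientations are tabulated. *)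
Definition next_state (st : (bool * nat) * {set V}) (v : V) :=
  if v \in margin then (st.1, block_swap block st.2 v)
  else ((~~ st.1.1, response (~~ st.1.1) (row_type v) (col_type v)), st.2).

Lemma eternal_all_win_grid :
  0 < t -> 0 < s ->
  eternal_all_win (@strong_adj m n) #|main_guards (false, 0) :|: block_corners|.
Proof.
move=> t_gt0 s_gt0.
pose conf (st : (bool * nat) * {set V}) := main_guards st.1 :|: st.2.
pose inv (st : (bool * nat) * {set V}) :=
  st.1.2 < 7 /\ block_transversal block margin st.2.
apply: (@eternal_all_win_states _ _ _ conf next_state inv
         ((false, 0), block_corners)).
  by split=> //; apply: block_corners_transversal.
move=> [[o c] T] v [/= c7 tT]; have TR : T \subset margin by case: tT.
have dis st (S : {set V}) : S \subset margin -> [disjoint main_guards st & S].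
  by move=> SR; rewrite (disjointWr SR) ?main_guards_margin.
rewrite /next_state /conf /inv; case: ifPn => [Rv|NRv] /=.
  have tT' := block_swap_transversal Rv tT.
  split=> //; last by rewrite inE setU11 orbT.
  apply: guard_moveU; rewrite ?dis //; first by case: tT'.
    exact: guard_move_refl.
  exact: (block_swap_move (@block_clique) Rv tT).
have [xP yP] := notin_margin NRv; have [r7 Gv] := responseP (~~ o) xP yP.
split=> //; last by rewrite inE [v \in main_guards _]inE Gv.
apply: guard_moveU; rewrite ?dis //; last exact: guard_move_refl.
case: o r7 {Gv} => r7; last exact: guard_move_main.
by apply: guard_move_sym; [exact: strong_adj_sym | exact: guard_move_main].
Qed.

(** * Counting the guards *)

Lemma card_even_ord (k r : nat) :
  r <= k -> #|[set x : 'I_k | (x < r) && ~~ odd x]| = uphalf r.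
Proof.
move=> rk; rewrite -sum1_card; under eq_bigl do rewrite inE andbC.
rewrite -(big_ord_widen_cond k (fun i => ~~ odd i) (fun=> 1) rk) big_mkcond /=.
elim: r {rk} => [|r IHr]; first by rewrite big_ord0.
by rewrite big_ord_recr /= IHr; case: ifP; lia.
Qed.

(** Inclusion-exclusion for the two strips forming the margin, with the overlap added on the left to
    avoid truncated subtraction. *)
Lemma card_block_corners :
  #|block_corners| + uphalf p * uphalf q =
  uphalf p * uphalf n + uphalf m * uphalf q.
Proof.
pose E k r := [set x : 'I_k | (x < r) && ~~ odd x].
have -> : block_corners = setX (E m p) (E n n) :|: setX (E m m) (E n q).
  apply/setP=> -[x y]; rewrite !inE /= !ltn_ord /=.
  by case: odd; case: odd; rewrite ?andbF ?andbT.
have -> : uphalf p * uphalf q =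
          #|setX (E m p) (E n n) :&: setX (E m m) (E n q)|.
  have -> : setX (E m p) (E n n) :&: setX (E m m) (E n q) =
            setX (E m p) (E n q).
    apply/setP=> -[x y]; rewrite !inE /= !ltn_ord /=.
    by case: odd; case: odd; rewrite ?andbF ?andbT.
  by rewrite cardsX !card_even_ord ?leq_addr.
by rewrite cardsUI !cardsX !card_even_ord ?leq_addr.
Qed.

Lemma card_main_guards0 :
  #|main_guards (false, 0)| = 7 * (t * s) + 10 * (t + s) + 4.
Proof.
rewrite card_main_guards card_profile_rows.
pose G X Y : nat := guard (false, 0) X Y.
pose f X := G X 1 + G X 9; pose g X := sumn [seq G X Y | Y <- iota 2 7].
rewrite -/f -/g /card_profile.
(* Per period, each side carries 5 guards, so two opposite sides carry 10; a 7 x 7 interior piece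
   holds 7 lattice guards; the corners give the two values 2. *)
have -> : sumn [seq f X | X <- iota 2 7] = 10 by vm_compute.
have -> : sumn [seq g X | X <- iota 2 7] = 7 by vm_compute.
have [-> ->] : f 1 = 2 /\ f 9 = 2 by split; vm_compute.
have [-> ->] : g 1 = 5 /\ g 9 = 5 by split; vm_compute.
lia.
Qed.

End Grid.

(** For an excess [m - b] of 0, ..., 6 the coefficients are 0, 1, 1, 2, 2, 3, 3. *)
Lemma alpha_coefE b m :
  b %% 7 = 2 -> b <= m < b + 7 -> alpha_coef m = uphalf (m - b).
Proof.
move=> b2 /andP[bm mb]; rewrite /alpha_coef.
have [d dE] : exists d, m - b = d by eexists.
have -> : m %% 7 = (2 + d) %% 7 by rewrite -dE; lia.
by rewrite dE; case: d dE => [|[|[|[|[|[|[|]]]]]]] //; lia.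
Qed.

(* gamma^infty_all(P_m [x] P_n) <= RHS, expressed as: some winning number k
   of guards is <= RHS (the minimum is then <= RHS as well). *)
Theorem theorem3 (n m a b : nat) (hn : 9 <= n) (hm : 9 <= m)
  (ha : a <= n) (ha2 : a %% 7 = 2)
  (hamax : forall c, c <= n -> c %% 7 = 2 -> c <= a)
  (hb : b <= m) (hb2 : b %% 7 = 2)
  (hbmax : forall c, c <= m -> c %% 7 = 2 -> c <= b) :
  exists k : nat,
    eternal_all_win (@strong_adj m n) k /\
    ((k%:R : rat) <=
       (a * b)%:R / 7%:R + 8%:R / 7%:R * ((a + b)%:R - 1)
       + (alpha_coef m)%:R * (uphalf n)%:R
       + (alpha_coef n)%:R * (uphalf m)%:R
       - (alpha_coef m * alpha_coef n)%:R)%R.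
Proof.
(* [a + 7] has the same residue as [a], so by maximality it exceeds [n]. *)
have a7 : n < a + 7 by rewrite ltnNge; apply/negP => /hamax; lia.
have b7 : m < b + 7 by rewrite ltnNge; apply/negP => /hbmax; lia.
have alphaE : alpha_coef m = uphalf (m - b) by apply: alpha_coefE; lia.
have betaE : alpha_coef n = uphalf (n - a) by apply: alpha_coefE; lia.
have [s sE] : exists s, a = 7 * s + 2 by exists (a %/ 7); lia.
have [t tE] : exists t, b = 7 * t + 2 by exists (b %/ 7); lia.
have s_gt0 : 0 < s by lia.
have t_gt0 : 0 < t by lia.
have [q nE] : exists q, n = q + (7 * s + 2) by exists (n - a); lia.
have [p mE] : exists p, m = p + (7 * t + 2) by exists (m - b); lia.
subst a b n m; rewrite alphaE betaE !addnK.
exists #|main_guards p t q s (false, 0) :|: block_corners p t q s|.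
split; first exact: eternal_all_win_grid.
have [+ _] := leq_card_setU (main_guards p t q s (false, 0))
                            (block_corners p t q s).
(* With sides [7 * s + 2] and [7 * t + 2], the first two terms of the bound equal the count of main
   guards exactly; [cornersE] accounts for the rest. *)
rewrite card_main_guards0 -(ler_nat rat) => /le_trans; apply.
have := congr1 (fun k => k%:R : rat)%R (card_block_corners p t q s).
rewrite !natrD !natrM => cornersE.
lra.
Qed.
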